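(* Let $k$ be a field of characteristic $0$, and let $d$ be the $k$-derivation of the polynomial ring $k[x,y,z,t]$ in four variables defined by $$d(x)=t^2,\quad d(y)=zt,\quad d(z)=y^2,\quad d(t)=xy.$$ Then $d$ has no Darboux polynomials in $k[x,y,z,t]$ if and only if $d$ has a trivial field of constants, i.e. $k(x,y,z,t)^d=k$.
   Context: A Darboux polynomial of a $k$-derivation $d$ of $k[x,y,z,t]$ is a polynomial $F\in k[x,y,z,t]$ with $F\notin k$ such that $d(F)=\Lambda F$ for some $\Lambda\in k[x,y,z,t]$ (the case $\Lambda=0$ is allowed). The derivation $d$ extends uniquely to a derivation, also denoted $d$, of the field of rational functions $k(x,y,z,t)$ (by the quotient rule). The field of constants of $d$ is $k(x,y,z,t)^d=\{\varphi\in k(x,y,z,t) : d(\varphi)=0\}$, and it is called trivial if it equals $k$. *)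

(* Defs.v *)
From HB Require Import structures.
From mathcomp Require Import all_boot all_algebra generic_quotient fraction.
From mathcomp Require Import ring mpoly.

Set Implicit Arguments.
Unset Strict Implicit.
Unset Printing Implicit Defensive.

Import GRing.Theory.
Local Open Scope ring_scope.

Notation "x %:F" := (@FracField.tofrac _ x) : ring_scope.

Definition derivation (R : nzRingType) (d : R -> R) : Prop :=
  {morph d : p q / p + q} /\ (forall p q, d (p * q) = d p * q + p * d q).

Definition kderivation (k : nzRingType) (A : algType k) (d : A -> A) : Prop :=
  linear d /\ (forall p q, d (p * q) = d p * q + p * d q).

Section PolyDerivation.
Variables (k : fieldType) (n : nat).
Implicit Types (f : 'I_n -> {mpoly k[n]}) (p q : {mpoly k[n]}).

(* The unique k-derivation with 'X_i |-> f i: see [mpoly_der_kderivation],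
   [mpoly_derX] and [mpoly_der_unique]. *)
Definition mpoly_der f p : {mpoly k[n]} := \sum_(i < n) f i * p^`M(i).

Lemma mpoly_der_kderivation f : kderivation (mpoly_der f).
Proof.
split=> [c p q|p q]; rewrite /mpoly_der.
  rewrite scaler_sumr -big_split; apply: eq_bigr => i _ /=.
  by rewrite mderivD mderivZ mulrDr scalerAr.
rewrite mulr_suml mulr_sumr -big_split; apply: eq_bigr => i _ /=.
by rewrite mderivM; ring.
Qed.

Lemma mpoly_derX f i : mpoly_der f 'X_i = f i.
Proof.
rewrite /mpoly_der (bigD1 i) //= big1 => [|j ji]; rewrite mderivX mnm1E.
  by rewrite eqxx scale1r -{1}(add0m U_(i)%MM) addmK mpolyX0 mulr1 addr0.
by rewrite eq_sym (negbTE ji) scale0r mulr0.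
Qed.

Lemma mpoly_der_unique f (D : {mpoly k[n]} -> {mpoly k[n]}) :
  kderivation D -> (forall i, D 'X_i = f i) -> D =1 mpoly_der f.
Proof.
move=> [Dl DM] DX; have [dl dM] := mpoly_der_kderivation f.
pose E p := D p - mpoly_der f p.
have El : forall c p q, E (c *: p + q) = c *: E p + E q.
  by move=> c p q; rewrite /E Dl dl scalerBr opprD addrACA.
have EM p q : E (p * q) = E p * q + p * E q.
  by rewrite /E DM dM mulrBl mulrBr opprD addrACA.
have E1 : E 1 = 0.
  by have /esym/eqP := EM 1 1; rewrite !mulr1 !mul1r -subr_eq0 addrK => /eqP.
have ED p q : E (p + q) = E p + E q by have := El 1 p q; rewrite !scale1r.
have E0 : E 0 = 0 by have := El (-1) 0 0; rewrite !scaleN1r oppr0 addr0 addNr.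
have EX i : E 'X_i = 0 by rewrite /E DX mpoly_derX subrr.
have EXm (m : 'X_{1..n}) : E 'X_[m] = 0.
  rewrite mpolyXE_id; apply: (big_ind (fun p => E p = 0)) => // [p q Ep Eq|i _].
    by rewrite EM Ep Eq mul0r mulr0 addr0.
  by elim: (m i) => // j IH; rewrite exprS EM EX IH mul0r mulr0 addr0.
move=> p; apply/eqP; rewrite -subr_eq0 -/(E p); apply/eqP.
elim/mpolyind: p => // c m p _ _ Ep.
by rewrite El Ep EXm scaler0 addr0.
Qed.

End PolyDerivation.

Section FracDerivation.
Variable R : idomainType.
Implicit Types (d : R -> R) (a b : R) (u v : {fraction R}).

Definition frac_num u : R := \n_(repr u).
Definition frac_den u : R := \d_(repr u).

Lemma frac_den_neq0 u : frac_den u != 0.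
Proof. exact: denom_ratioP. Qed.

Lemma frac_numden u : u = (frac_num u)%:F / (frac_den u)%:F.
Proof.
have d0 : (frac_den u)%:F != 0 by rewrite tofrac_eq0 frac_den_neq0.
apply: (canRL (mulfK d0)).
rewrite /frac_num /frac_den -[in LHS](reprK u); unlock FracField.tofrac.
rewrite -[LHS]FracField.pi_mul; apply/eqP.
rewrite FracField.equivf_def /FracField.mulf /= !numden_Ratio ?mulr1 ?oner_neq0 ?denom_ratioP //.
by rewrite reprK mulrC.
Qed.

(* The quotient rule, on the representative chosen by the quotient type
   {fraction R}.  When d is a derivation, [frac_der_eq] shows that the choice is
   irrelevant, and [frac_der_derivation], [frac_der_tofrac] and
   [frac_der_unique] that this is the unique derivation extending d. *)
Definition frac_der d u : {fraction R} :=
  (d (frac_num u) * frac_den u - frac_num u * d (frac_den u))%:F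
    / ((frac_den u) ^+ 2)%:F.

Section Theory.
Variable d : R -> R.
Hypothesis dd : derivation d.

Lemma derivation1 : d 1 = 0.
Proof.
case: dd => _ /(_ 1 1)/esym/eqP.
by rewrite !mulr1 mul1r -subr_eq0 addrK => /eqP.
Qed.

Lemma frac_der_eq a b : b != 0 ->
  frac_der d (a%:F / b%:F) = (d a * b - a * d b)%:F / (b ^+ 2)%:F.
Proof.
move=> b0; case: dd => dD dM; rewrite /frac_der.
set u := a%:F / b%:F; set n := frac_num u; set e := frac_den u.
have e0 : e != 0 := frac_den_neq0 u.
have eF : e%:F != 0 by rewrite tofrac_eq0.
have bF : b%:F != 0 by rewrite tofrac_eq0.
have E : n * b = a * e.
  apply/eqP; rewrite -tofrac_eq !tofracM -eqr_div //; apply/eqP.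
exact: (esym (frac_numden u)).
have E' : d n * b + n * d b = d a * e + a * d e by rewrite -!dM E.
apply/eqP; rewrite eqr_div ?tofrac_eq0 ?expf_neq0 // -!tofracM tofrac_eq.
apply/eqP; rewrite !expr2.
have -> : (d n * e - n * d e) * (b * b) = (d n * b + n * d b) * b * e
  - (n * b) * (b * d e + e * d b) by ring.
by rewrite E E'; ring.
Qed.

Lemma frac_der_derivation : derivation (frac_der d).
Proof.
have [dD dM] := dd.
have H u v : exists a b a' b', [/\ b != 0, b' != 0, u = a%:F / b%:F
    & v = a'%:F / b'%:F].
  exists (frac_num u), (frac_den u), (frac_num v), (frac_den v).
  by split; rewrite ?frac_den_neq0 -?frac_numden.
split=> u v; have [a [b [a' [b' [b0 b0' -> ->]]]]] := H u v.
  rewrite addf_div ?tofrac_eq0 // -!tofracM -tofracD.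
  rewrite !frac_der_eq ?mulf_neq0 // addf_div ?tofrac_eq0 ?expf_neq0 //.
  apply/eqP; rewrite -!tofracM -tofracD eqr_div ?tofrac_eq0 ?mulf_neq0 ?expf_neq0 //.
  rewrite -!tofracM tofrac_eq !dD !dM; apply/eqP; ring.
rewrite mulf_div -!tofracM !frac_der_eq ?mulf_neq0 // !mulf_div -!tofracM.
rewrite addf_div ?tofrac_eq0 ?mulf_neq0 ?expf_neq0 // -!tofracM -tofracD.
apply/eqP; rewrite eqr_div ?tofrac_eq0 ?mulf_neq0 ?expf_neq0 //.
by rewrite -!tofracM tofrac_eq !dM; apply/eqP; ring.
Qed.

Lemma frac_der_tofrac a : frac_der d a%:F = (d a)%:F.
Proof.
have := frac_der_eq a (oner_neq0 R).
by rewrite derivation1 mulr0 subr0 mulr1 expr1n tofrac1 !divr1.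
Qed.

Lemma frac_der_unique (D : {fraction R} -> {fraction R}) :
  derivation D -> (forall a, D a%:F = (d a)%:F) -> D =1 frac_der d.
Proof.
move=> [_ DM] De u; have [_ fM] := frac_der_derivation.
have d0 : (frac_den u)%:F != 0 by rewrite tofrac_eq0 frac_den_neq0.
have E : u * (frac_den u)%:F = (frac_num u)%:F by rewrite {1}(frac_numden u) divfK.
have := DM u (frac_den u)%:F; have := fM u (frac_den u)%:F.
rewrite E !De !frac_der_tofrac => -> /addIr /(mulIf d0) //.
Qed.

End Theory.
End FracDerivation.

Section Darboux.
Variables (k : fieldType) (n : nat).
Local Notation P := {mpoly k[n]}.

Definition darboux (d : P -> P) (F : P) : Prop :=
  (~ exists c : k, F = c%:MP) /\ exists L : P, d F = L * F.

Definition frac_const (d : P -> P) (phi : {fraction P}) : Prop :=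
  frac_der d phi = 0.

Definition trivial_frac_const (d : P -> P) : Prop :=
  forall phi : {fraction P}, frac_const d phi <-> exists c : k, phi = c%:MP%:F.

End Darboux.

Section MonomialDerivation.
Variable k : fieldType.

Let x : {mpoly k[4]} := 'X_0.
Let y : {mpoly k[4]} := 'X_1.
Let z : {mpoly k[4]} := 'X_2.
Let t : {mpoly k[4]} := 'X_3.

Definition d4 : {mpoly k[4]} -> {mpoly k[4]} :=
  mpoly_der (tnth [tuple t ^+ 2; z * t; y ^+ 2; x * y]).

Lemma d4_vars : [/\ d4 x = t ^+ 2, d4 y = z * t, d4 z = y ^+ 2 & d4 t = x * y].
Proof. by rewrite /d4 !mpoly_derX. Qed.

End MonomialDerivation.

Arguments d4 : clear implicits.

(* Main.v *)
(* Give x, y, z, t the weights 7, 4, 3, 6.  Then d is homogeneous of degree 5,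
   so a cofactor L in d(F) = L F (F nonzero) is homogeneous of weight 5: compare
   the top and bottom weighted components of both sides.  No monomial has
   weight 5, hence L = 0, and every Darboux polynomial is a nontrivial constant.

   Conversely k[x,y,z,t] is factorial, so a rational constant can be written
   p/q in lowest terms; q divides p d(q), hence d(q), so without Darboux
   polynomials q is in k, then d(p) = 0 and p is in k. *)
Require Import Defs.
From HB Require Import structures.
From mathcomp Require Import all_boot all_algebra fraction mpoly.
From mathcomp Require Import ring zify.
From Stdlib Require Import Classical_Prop.

Set Implicit Arguments.
Unset Strict Implicit.
Unset Printing Implicit Defensive.

Import GRing.Theory.
Local Open Scope ring_scope.

(** * Divisibility, prime factorizations and fractions in lowest terms *)

Section Factorial.
Variable R : idomainType.
Implicit Types a b c p q u : R.

Definition rdivides a b : Prop := exists c, b = a * c.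

Definition prime_elt p : Prop :=
  [/\ p != 0, ~ rdivides p 1
    & forall a b, rdivides p (a * b) -> rdivides p a \/ rdivides p b].

Inductive prime_product : R -> Prop :=
| PrimeProductUnit u of rdivides u 1 : prime_product u
| PrimeProductMul p a of prime_elt p & prime_product a : prime_product (p * a).

(** With factors that are prime, and not merely irreducible, existence of a factorization already
    forces its uniqueness, so this is the usual notion of a factorial domain. *)
Definition factorial : Prop := forall a, a != 0 -> prime_product a.

Lemma rdivides_trans b a c : rdivides a b -> rdivides b c -> rdivides a c.
Proof. by move=> [e ->] [f ->]; exists (e * f); rewrite mulrA. Qed.

Lemma rdivides0 a : rdivides a 0.
Proof. by exists 0; rewrite mulr0. Qed.

Lemma rdivides_mulr a b c : rdivides a b -> rdivides a (b * c).
Proof. by move=> [e ->]; exists (e * c); rewrite mulrA. Qed.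

Lemma rdivides_mull a b c : rdivides a b -> rdivides a (c * b).
Proof. by rewrite mulrC; apply: rdivides_mulr. Qed.

Lemma rdividesD a b c : rdivides a b -> rdivides a c -> rdivides a (b + c).
Proof. by move=> [e ->] [f ->]; exists (e + f); rewrite mulrDr. Qed.

Lemma rdividesB a b c : rdivides a b -> rdivides a c -> rdivides a (b - c).
Proof. by move=> [e ->] [f ->]; exists (e - f); rewrite mulrBr. Qed.

Lemma rdivides_mul2l p a b :
  p != 0 -> rdivides (p * a) (p * b) -> rdivides a b.
Proof. by move=> p0 [e]; rewrite -mulrA => /(mulfI p0) ->; exists e. Qed.

Lemma rdivides_unit u a : rdivides u 1 -> rdivides u a.
Proof. by move=> u1; rewrite -[a]mul1r; apply: rdivides_mulr. Qed.

Lemma prime_productM a b :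
  prime_product a -> prime_product b -> prime_product (a * b).
Proof.
move=> pa pb; elim: pa => {a} [u [v uv]|p a pp _ IH].
  elim: pb => {b} [w [x wx]|p b pp _ IH].
    apply: PrimeProductUnit; exists (v * x).
    by rewrite mulrACA -uv -wx mulr1.
  by rewrite mulrCA; apply: PrimeProductMul.
by rewrite -mulrA; apply: PrimeProductMul.
Qed.

(** The primes of [c] are peeled off one at a time: each divides [f * g] but not [f], hence divides
    [g]. *)
Lemma prime_product_cancel c f g : prime_product c ->
  (forall p, prime_elt p -> rdivides p c -> ~ rdivides p f) ->
  rdivides c (f * g) -> rdivides c g.
Proof.
move=> pc; elim: pc g => {c} [u u1|p a pp _ IH] g cop dv.
  exact: rdivides_unit.
have [p0 _ pP] := pp.
have pf : ~ rdivides p f by apply: cop => //; exists a.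
have pfg : rdivides p (f * g) by apply: rdivides_trans dv; exists a.
case: (pP _ _ pfg) => // -[h gE]; rewrite gE.
suff [e ->] : rdivides a h by exists e; rewrite mulrA.
apply: IH => [q pq [e aE]|].
  by apply: cop => //; exists (p * e); rewrite aE mulrCA.
by apply: (rdivides_mul2l p0); rewrite mulrCA -gE.
Qed.

(** Coprimality of [p'] and [q'] is expressed by the cancellation property that is used later. In
    the induction on the factorization of [q], a new prime goes into [g] if it divides [p'], and
    stays in the denominator otherwise. *)
Lemma lowest_terms q p : prime_product q -> exists g p' q',
  [/\ p = g * p', q = g * q'
    & forall a, rdivides q' (p' * a) -> rdivides q' a].
Proof.
elim=> {q} [u u1|r q pr _ [g [p' [q' [pE qE cop]]]]].
  exists 1, p, u; split; rewrite ?mul1r // => a _; exact: rdivides_unit.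
have [r0 _ rP] := pr.
case: (classic (rdivides r p')) => [[p'' p'E]|rp'].
  exists (g * r), p'', q'; split; first by rewrite pE p'E mulrA.
    by rewrite qE mulrCA mulrA.
  move=> a dv; apply: cop; rewrite p'E -mulrA; exact: rdivides_mull.
exists g, p', (r * q'); split=> //; first by rewrite qE mulrCA.
move=> a dv.
have : rdivides r (p' * a) by apply: rdivides_trans dv; exists q'.
case/rP=> // -[b aE]; rewrite aE in dv *.
have [e ->] : rdivides q' b.
  by apply: cop; apply: (rdivides_mul2l r0); rewrite mulrCA.
by exists e; rewrite mulrA.
Qed.

End Factorial.

(** Transports factoriality along a ring isomorphism; [f] inherits multiplicativity from its inverse
    [g]. *)
Lemma factorial_iso (R S : idomainType) (f : R -> S) (g : {rmorphism S -> R}) :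
  cancel f g -> cancel g f -> factorial R -> factorial S.
Proof.
move=> fK gK facR.
have fM : {morph f : x y / x * y}.
  by move=> x y; apply: (can_inj gK); rewrite rmorphM !fK.
have f1 : f 1 = 1 by rewrite -(rmorph1 g) gK.
have f0 : f 0 = 0 by rewrite -(rmorph0 g) gK.
have dvf a b : rdivides a b -> rdivides (f a) (f b).
  by move=> [c ->]; exists (f c); rewrite fM.
have dvg a b : rdivides (f a) b -> rdivides a (g b).
  by move=> [c ->]; exists (g c); rewrite rmorphM fK.
have prf p : prime_elt p -> prime_elt (f p).
  move=> [p0 p1 pP]; split; first by rewrite -f0 (inj_eq (can_inj fK)).
    by rewrite -f1 => /dvg; rewrite fK.
  by move=> a b /dvg; rewrite rmorphM => /pP[] /dvf; rewrite gK; [left|right].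
move=> a a0; rewrite -(gK a).
have: prime_product (g a).
  by apply: facR; rewrite -(rmorph0 g) (inj_eq (can_inj gK)).
elim=> {a0} [u u1|p b pp _ IH].
  by apply: PrimeProductUnit; rewrite -f1; apply: dvf.
by rewrite fM; apply: PrimeProductMul; first apply: prf.
Qed.

(** * Gauss's theorem: polynomials over a factorial domain form a factorial domain *)

Section PolyFactorial.
Variable R : idomainType.
Implicit Types (a b c p : R) (f g h w : {poly R}).

Lemma rdivides_polyC p f : (forall i, rdivides p f`_i) -> rdivides p%:P f.
Proof.
elim/poly_ind: f => [_|f c IH H]; first exact: rdivides0.
apply: rdividesD.
  apply: rdivides_mulr; apply: IH => i.
  by have := H i.+1; rewrite coefD coefMX coefC /= addr0.
have := H 0%N; rewrite coefD coefMX coefC /= add0r => -[e ->].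
by exists e%:P; rewrite polyCM.
Qed.

Lemma rdivides_coef p f i : rdivides p%:P f -> rdivides p f`_i.
Proof. by move=> [g ->]; rewrite coefCM; exists g`_i. Qed.

Lemma rdivides_mulX p f : rdivides p%:P (f * 'X) -> rdivides p%:P f.
Proof.
move=> H; apply: rdivides_polyC => i.
by have := rdivides_coef i.+1 H; rewrite coefMX.
Qed.

(** [p] divides the product of the constant terms, hence one of them. Subtracting that term leaves a
    multiple of ['X]; cancelling ['X] lowers the degree of one factor, and induction applies. *)
Lemma prime_polyC p : prime_elt p -> prime_elt p%:P.
Proof.
move=> [p0 p1 pP]; split; first by rewrite polyC_eq0.
  by move=> /(rdivides_coef 0); rewrite coefC.
elim/poly_ind=> [|f c IHf] g; first by left; apply: rdivides0.
elim/poly_ind: g => [|g e IHg] dv; first by right; apply: rdivides0.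
have: rdivides p (c * e).
  have := rdivides_coef 0 dv.
  by rewrite coef0M !coefD !coefMX !coefC /= !add0r.
have pC b : rdivides p b -> rdivides p%:P b%:P.
  by move=> [x ->]; exists x%:P; rewrite polyCM.
case/pP => /pC pdv.
  have: rdivides p%:P (f * (g * 'X + e%:P)).
    apply: rdivides_mulX.
    rewrite (_ : _ * 'X = (f * 'X + c%:P) * (g * 'X + e%:P)
      - c%:P * (g * 'X + e%:P)); last by ring.
    by apply: rdividesB => //; apply: rdivides_mulr.
  case/IHf => H; [left|by right].
  by apply: rdividesD => //; apply: rdivides_mulr.
have: rdivides p%:P ((f * 'X + c%:P) * g).
  apply: rdivides_mulX.
  rewrite (_ : _ * 'X = (f * 'X + c%:P) * (g * 'X + e%:P)
    - (f * 'X + c%:P) * e%:P); last by ring.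
  by apply: rdividesB => //; apply: rdivides_mull.
case/IHg => H; [by left|right].
by apply: rdividesD => //; apply: rdivides_mulr.
Qed.

Lemma prime_product_polyC c : prime_product c -> prime_product c%:P.
Proof.
elim=> {c} [u [v uv]|p a pp _ IH].
  by apply: PrimeProductUnit; exists v%:P; rewrite -polyCM -uv.
by rewrite polyCM; apply: PrimeProductMul => //; apply: prime_polyC.
Qed.

(** Unit content, phrased without gcds of coefficients. *)
Definition primitive f : Prop := forall a, rdivides a%:P f -> rdivides a 1.

Hypothesis facR : factorial R.

Lemma primitive_part f : f != 0 ->
  exists c f0, [/\ c != 0, f = c%:P * f0 & primitive f0].
Proof.
(* [l] bounds the constants dividing [f], and is peeled off prime by prime *)
suff H l : prime_product l -> forall f, f != 0 ->
    (forall a, rdivides a%:P f -> rdivides a l) ->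
    exists c f0, [/\ c != 0, f = c%:P * f0 & primitive f0].
  move=> f0; apply: (H (lead_coef f)) => //; last first.
    move=> a; exact: rdivides_coef.
  by apply: facR; rewrite lead_coef_eq0.
elim=> {f l} [l l1|p l pp _ IH] f f0 dvl.
  exists 1, f; split; rewrite ?oner_eq0 ?mul1r // => a /dvl al.
  exact: rdivides_trans al l1.
have [p0 _ pP] := pp.
case: (classic (rdivides p%:P f)) => [[g fE]|pf].
  have g0 : g != 0 by apply: contraNneq f0 => g0; rewrite fE g0 mulr0.
  have dvg a : rdivides a%:P g -> rdivides a l.
    move=> [e aE]; apply: (rdivides_mul2l p0); apply: dvl.
    by exists e; rewrite fE aE polyCM mulrA.
  have [c [h [c0 gE ph]]] := IH g g0 dvg.
  by exists (p * c), h; split; rewrite ?mulf_neq0 // fE gE polyCM mulrA.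
apply: IH => // a af; have [h lE] := dvl a af.
(* Here [p * l = a * h]. The prime [p] cannot divide [a], since it would then divide [f]; so it
   divides [h], and [a] divides [l]. *)
have: rdivides p (a * h) by exists l.
case/pP => [[e aE]|[e hE]].
  by case: pf; apply: rdivides_trans af; exists e%:P; rewrite aE polyCM.
by exists e; apply: (mulfI p0); rewrite lE hE mulrCA.
Qed.

(** With [c%:P * g = f * e], no prime factor of [c] divides the primitive [f], so [c] divides [e]
    and can be cancelled. *)
Lemma primitive_cancel f g c :
  primitive f -> c != 0 -> rdivides f (c%:P * g) -> rdivides f g.
Proof.
move=> pf c0 [e E].
have cP0 : c%:P != 0 :> {poly R} by rewrite polyC_eq0.
have [e' eE] : rdivides c%:P e.
  apply: (@prime_product_cancel _ _ f); last by exists g.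
    exact/prime_product_polyC/facR.
  move=> p [_ p1 _] [h pE] pdf; apply: p1.
  (* A divisor of a nonzero constant has degree 0, so primitivity of [f] applies to it. *)
  have pC : p = (p`_0)%:P.
    apply: size1_polyC; have: size (p * h) == 1%N by rewrite -pE size_polyC c0.
    by rewrite size_mul_eq1 => /andP[/eqP->].
  rewrite pC in pdf *; have [v E1] := pf _ pdf.
  by exists v%:P; rewrite -polyCM -E1.
by exists e'; apply: (mulfI cP0); rewrite E eE mulrCA.
Qed.

(** Each prime factor of [c] stays prime in [{poly R}], so it divides [g] or [h] and is cancelled
    there without changing degrees. *)
Lemma constant_cancel c f g h : c != 0 -> c%:P * f = g * h ->
  exists g' h', [/\ f = g' * h', size g' = size g & size h' = size h].
Proof.
move=> /facR pc; elim: pc f g h => {c} [u [v uv]|p a pp _ IH] f g h.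
  move=> E; exists (v%:P * g), h; split=> //.
    by rewrite -mulrA -E mulrA -polyCM [v * u]mulrC -uv mul1r.
  rewrite size_Cmul //; apply: contra_eq_neq uv => ->; rewrite mulr0.
  exact: oner_neq0.
have [p0 _ _] := pp; have [pP0 _ pP] := prime_polyC pp.
rewrite polyCM -mulrA => E.
have: rdivides p%:P (g * h) by rewrite -E; exists (a%:P * f).
case/pP => -[e eE]; rewrite eE size_Cmul //; apply: IH; apply: (mulfI pP0).
  by rewrite E eE mulrA.
by rewrite E eE mulrCA.
Qed.

(** If [f] is coprime to [g], it divides [h] up to a constant. Otherwise the gcd is a nonconstant
    factor of [f] up to a constant, so irreducibility gives it the degree of [f], and [f] divides
    [g]. *)
Lemma irreducible_prime f : primitive f -> (1 < size f)%N ->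
  (forall g h, f = g * h -> (size g <= 1)%N \/ (size h <= 1)%N) ->
  prime_elt f.
Proof.
move=> pf f1 irr.
have f0 : f != 0 by rewrite -size_poly_gt0 ltnW.
(* Over a domain [%|] is divisibility up to a nonzero constant multiple; primitivity of [f] removes
   the constant. *)
have dvdpf g : f %| g -> rdivides f g.
  case/Pdiv.Idomain.dvdpP => -[c r] /= c0 E; apply: (primitive_cancel pf c0).
  by exists r; rewrite mul_polyC E mulrC.
split=> // [[g /esym E]|g h [e E]].
  have: size (f * g) == 1%N by rewrite E size_poly1.
  by rewrite size_mul_eq1 gtn_eqF.
have fgh : f %| g * h by rewrite E dvdp_mulIl.
case: (boolP (coprimep f g)) => cop.
  by right; apply: dvdpf; rewrite -(Gauss_dvdpr _ cop).
left; apply: dvdpf.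
have /Pdiv.Idomain.dvdpP[[c r] /= c0 E1] := dvdp_gcdl f g.
rewrite -mul_polyC in E1.
have [w [s [fE sw ss]]] := constant_cancel c0 E1.
have gcd1 : (1 < size (gcdp f g))%N.
  have : gcdp f g != 0 by rewrite gcdp_eq0 negb_and f0.
  move: cop; rewrite /coprimep -size_poly_gt0.
  by case: (size _) => [|[|n]].
have w1 : (size w <= 1)%N.
  by have [|] := irr _ _ fE; rewrite ?ss // leqNgt gcd1.
have w0 : w != 0 by apply: contraNneq f0 => w0; rewrite fE w0 mul0r.
have s0 : s != 0 by apply: contraNneq f0 => s0; rewrite fE s0 mulr0.
have sz : size (gcdp f g) = size f.
  rewrite -ss fE size_mul //; move: w1 w0; rewrite -size_poly_gt0.
  by case: (size w) => [|[|n]].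
have := dvdp_size_eqp (dvdp_gcdl f g); rewrite sz eqxx => /esym eqf.
by rewrite -(eqp_dvdl _ eqf) dvdp_gcdr.
Qed.

(** Induction on the degree: after extracting the content, the primitive part is constant, splits
    into two factors of smaller degree, or is prime by [irreducible_prime]. *)
Theorem poly_factorial : factorial {poly R}.
Proof.
move=> f; have [n] := ubnP (size f); elim: n f => // n IH f sf f0.
have [c [g [c0 fE pg]]] := primitive_part f0.
rewrite fE; apply: prime_productM; first exact/prime_product_polyC/facR.
have g0 : g != 0 by apply: contraNneq f0 => g0; rewrite fE g0 mulr0.
have sg : (size g <= n)%N by rewrite -ltnS -(size_Cmul g c0) -fE.
have [g1|g1] := leqP (size g) 1.
  rewrite (size1_polyC g1); apply/prime_product_polyC/facR.
  by rewrite -polyC_eq0 -size1_polyC.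
case: (classic (exists h1 h2,
    [/\ g = h1 * h2, (1 < size h1)%N & (1 < size h2)%N])) => [|irr].
  move=> [h1 [h2 [gE s1 s2]]].
  have h10 : h1 != 0 by rewrite -size_poly_gt0 ltnW.
  have h20 : h2 != 0 by rewrite -size_poly_gt0 ltnW.
  have s12 := size_mul h10 h20; rewrite -gE in s12.
  rewrite gE; apply: prime_productM; apply: IH => //.
    apply: leq_trans sg; rewrite s12.
    by move: s2; case: (size h2) => [|[|m]] // _; rewrite !addnS ltnS leq_addr.
  apply: leq_trans sg; rewrite s12.
  by move: s1; case: (size h1) => [|[|m]] // _; rewrite !addSn ltnS leq_addl.
rewrite -[g]mulr1; apply: PrimeProductMul; last first.
  by apply: PrimeProductUnit; exists 1; rewrite mulr1.
apply: irreducible_prime => // h1 h2 gE.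
have [s1|s1] := leqP (size h1) 1; first by left.
have [s2|s2] := leqP (size h2) 1; first by right.
by case: irr; exists h1, h2.
Qed.

End PolyFactorial.

(** * Factoriality of [{mpoly k[n]}], by induction on the number of variables *)

Section MpolyFactorial.
Variable k : fieldType.

Section MuniIso.
Variable n : nat.
Implicit Types (m : 'X_{1..n.+1}) (q : {poly {mpoly k[n]}}).

Lemma muniX m : muni 'X_[m] =
  'X_[[multinom m (widen_ord (leqnSn n) i) | i < n]] *: 'X^(m ord_max) :> {poly {mpoly k[n]}}.
Proof. by rewrite muniE msuppX big_seq1 mcoeffX eqxx scale1r. Qed.

Lemma muni_mwiden (p : {mpoly k[n]}) : muni (mwiden p) = p%:P.
Proof.
elim/mpolyind: p => [|c m p _ _ IH]; first by rewrite mwiden0 muni0.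
rewrite mwidenD muniD IH mwidenZ muniZ mwidenX muniX mnmwiden_ordmax expr0.
rewrite alg_polyC polyCD -mul_polyC -polyCM mul_mpolyC.
rewrite (_ : [multinom _ | i < n] = m) //.
by apply/mnmP => i; rewrite mnmE mnmwiden_widen.
Qed.

(** Inverse of [muni], which reads a polynomial as univariate in its last variable. *)
Definition muni_inv q : {mpoly k[n.+1]} :=
  (map_poly (@mwiden n k) q).['X_ord_max].

Lemma muni_invD : {morph muni_inv : p q / p + q}.
Proof. by move=> p q; rewrite /muni_inv rmorphD hornerD. Qed.

Lemma muni_invK : cancel muni_inv (@muni n k).
Proof.
elim/poly_ind => [|q c IH]; first by rewrite /muni_inv rmorph0 horner0 muni0.
rewrite muni_invD /muni_inv rmorphM /= map_polyX hornerMX map_polyC hornerC.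
rewrite muniD muniM IH muni_mwiden muniX mnm1E eqxx expr1.
rewrite (_ : [multinom _ | i < n] = 0%MM) ?mpolyX0 ?scale1r //.
by apply/mnmP => i; rewrite mnmE mnm1E mnm0E -val_eqE /= gtn_eqF.
Qed.

Lemma muniK : cancel (@muni n k) muni_inv.
Proof.
elim/mpolyind=> [|c m p _ _ IH].
  by rewrite muni0 /muni_inv rmorph0 horner0.
rewrite muniD muni_invD IH muniZ muniX scalerA mul_mpolyC; congr (_ + _).
rewrite /muni_inv -mul_polyC rmorphM /= map_polyXn hornerM hornerXn.
rewrite map_polyC hornerC /= mwidenZ mwidenX -scalerAl mpolyXn -mpolyXD.
congr (_ *: 'X_[_]); apply/mnmP => i; rewrite mnmDE mulmnE mnm1E.
case: (unliftP ord_max i) => [j|] ->.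
  rewrite (_ : lift _ _ = widen_ord (leqnSn n) j); last first.
    by apply: val_inj; exact: lift_max.
  by rewrite mnmwiden_widen mnmE -val_eqE /= gtn_eqF // addn0.
by rewrite mnmwiden_ordmax eqxx mul1n.
Qed.

End MuniIso.

Theorem mpoly_factorial n : factorial {mpoly k[n]}.
Proof.
elim: n => [|n IH].
  (* Without variables, a nonzero polynomial is a nonzero scalar, hence a unit. *)
  move=> p p0; apply: PrimeProductUnit.
  have pE : p = (p@_0)%:MP.
    apply/mpolyP => m; have -> : m = 0%MM by apply/mnmP => -[].
    by rewrite mcoeffC eqxx mulr1.
  have c0 : p@_0 != 0 by apply: contraNneq p0 => c0; rewrite pE c0.
  by exists (p@_0)^-1%:MP; rewrite {1}pE -mpolyCM mulfV.
exact: (factorial_iso (@muni_invK n) (@muniK n) (poly_factorial IH)).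
Qed.

End MpolyFactorial.

(** * Weight gradings and cofactors of homogeneous derivations *)

(* Top and bottom degrees: those of [l * f] are between those of ['X^e * f],
   as [D] acts on coefficients only. *)
Lemma cofactor_monomial (R : idomainType) (D : R -> R) e (f l : {poly R}) :
  D 0 = 0 -> f != 0 -> 'X^e * map_poly D f = l * f -> l = l`_e *: 'X^e.
Proof.
move=> D0 f0 E; have [->|l0] := eqVneq l 0; first by rewrite coef0 scale0r.
have coefD i (g : {poly R}) : (map_poly D g)`_i = D g`_i by exact: coef_map_id0.
have sl : (size l <= e.+1)%N.
  have : (size (l * f)%R <= e + size f)%N.
    rewrite -E; apply: leq_trans (size_polyMleq _ _) _.
    by rewrite size_polyXn addSn leq_add2l size_poly.
  rewrite (size_mul l0 f0) -(prednK (_ : 0 < size f)%N) ?size_poly_gt0 //.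
  by rewrite !addnS /= -addSn leq_add2r.
(* [u] and [v] are the orders of [l] and [f] at 0. The factor ['X^v] cancels from the equation
   because [map_poly D] commutes with shifts of coefficients. *)
have [u [l1 l10 lE]] := multiplicity_XsubC l 0.
have [v [f1 f10 fE]] := multiplicity_XsubC f 0.
rewrite l0 subr0 /= in l10 lE; rewrite f0 subr0 /= in f10 fE.
have E1 : 'X^e * map_poly D f1 = l * f1.
  apply: (mulIf (_ : 'X^v != 0)); first by rewrite monic_neq0 ?monicXn.
  rewrite -[in RHS]mulrA -fE -E -mulrA; congr (_ * _); apply/polyP => i.
  by rewrite fE coefMXn !coefD coefMXn; case: ifP; rewrite ?D0.
(* If [u < e], cancelling ['X^u] makes [l1 * f1] vanish at 0, although neither factor does. *)
have eu : (e <= u)%N.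
  rewrite leqNgt; apply/negP => ue.
  have E2 : 'X^(e - u) * map_poly D f1 = l1 * f1.
    apply: (mulIf (_ : 'X^u != 0)); first by rewrite monic_neq0 ?monicXn.
    by rewrite [RHS]mulrAC -lE -E1 mulrAC -exprD subnK // ltnW.
  have : root (l1 * f1) 0.
    by rewrite -E2 rootE hornerM hornerXn expr0n subn_eq0 leqNgt ue mul0r.
  by rewrite rootM (negbTE l10) (negbTE f10).
have l1n0 : l1 != 0 by apply: contraNneq l0 => l10'; rewrite lE l10' mul0r.
move: sl; rewrite lE size_mulXn // => sl.
have ue : u = e.
  apply/eqP; rewrite eqn_leq eu andbT -ltnS; apply: leq_trans sl.
  by rewrite -addn1 leq_add2l size_poly_gt0.
have /size1_polyC -> : (size l1 <= 1)%N.
  by move: sl; rewrite ue -addn1 leq_add2l.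
by rewrite ue coefCM coefXn eqxx mulr1 mul_polyC.
Qed.

Section WeightedDerivation.
Variables (k : fieldType) (n : nat) (w : 'I_n -> nat).
Implicit Types (p q F L : {mpoly k[n]}) (m : 'X_{1..n}).

Definition mweight m : nat := \sum_(i < n) w i * m i.

(** Replaces each ['X_i] by ['X_i] times the [w i]-th power of a new variable: the coefficient of
    degree [a] is then the component of weight [a]. *)
Definition weight_subst : {mpoly k[n]} -> {poly {mpoly k[n]}} :=
  mmap (polyC \o @mpolyC n k) (fun i => 'X_i *: 'X^(w i)).

HB.instance Definition _ := GRing.RMorphism.on weight_subst.

Definition whomog a p : Prop := weight_subst p = p *: 'X^a.

Lemma whomogX i : whomog (w i) 'X_i.
Proof. by rewrite /whomog /weight_subst mmapX mmap1U. Qed.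

Lemma whomogM a b p q : whomog a p -> whomog b q -> whomog (a + b) (p * q).
Proof.
rewrite /whomog => pa qb.
by rewrite rmorphM /= pa qb -scalerAl -scalerAr scalerA -exprD.
Qed.

Lemma whomogD a p q : whomog a p -> whomog a q -> whomog a (p + q).
Proof. by rewrite /whomog => pa qa; rewrite rmorphD /= pa qa scalerDl. Qed.

Lemma weight_substZ c p : weight_subst (c *: p) = c%:MP *: weight_subst p.
Proof. by rewrite /weight_subst mmapZ /= mul_polyC. Qed.

Variables (d : {mpoly k[n]} -> {mpoly k[n]}) (e : nat).
Hypothesis dk : kderivation d.
Hypothesis dX : forall i, whomog (w i + e) (d 'X_i).

Let dD : {morph d : p q / p + q}.
Proof. by move=> p q; have [/(_ 1 p q)] := dk; rewrite !scale1r. Qed.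

Let dM p q : d (p * q) = d p * q + p * d q.
Proof. by have [_] := dk. Qed.

Let d0 : d 0 = 0.
Proof. by apply: (addIr (d 0)); rewrite -dD !add0r. Qed.

Let dZ c p : d (c *: p) = c *: d p.
Proof. by have [/(_ c p 0)] := dk; rewrite d0 !addr0. Qed.

(** Both claims are proved together, since the Leibniz rule needs the weights of the factors as well
    as those of their derivatives. *)
Lemma whomog_mpolyX m :
  whomog (mweight m) 'X_[m] /\ whomog (mweight m + e) (d 'X_[m]).
Proof.
pose H p a := whomog a p /\ whomog (a + e) (d p).
have HM p a q b : H p a -> H q b -> H (p * q) (a + b)%N.
  move=> [pa da] [qb db]; split; first exact: whomogM.
  rewrite dM; apply: whomogD; first by rewrite addnAC; apply: whomogM.
  by rewrite -addnA; apply: whomogM.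
have H1 : H 1 0%N.
  split; first by rewrite /whomog rmorph1 scale1r.
  by rewrite (@derivation1 _ d (conj dD dM)) /whomog rmorph0 scale0r.
rewrite mpolyXE_id -/(H _ _) /mweight.
apply: (big_ind2 H) => // i _.
elim: (m i) => [|j IH]; first by rewrite muln0.
by rewrite exprS mulnS; apply: HM => //; split; [exact: whomogX|exact: dX].
Qed.

Lemma coef_map_der (u : {poly {mpoly k[n]}}) i : (map_poly d u)`_i = d u`_i.
Proof. exact: coef_map_id0. Qed.

(** On a monomial, [d] raises the weight by exactly [e]; additivity extends this to all
    polynomials. *)
Lemma weight_subst_der p :
  weight_subst (d p) = 'X^e * map_poly d (weight_subst p).
Proof.
elim/mpolyind: p => [|c m p _ _ IH].
  by rewrite d0 rmorph0 (_ : map_poly d 0 = 0) ?mulr0 // map_poly0.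
have [mX dmX] := whomog_mpolyX m.
rewrite dD dZ 2!rmorphD /= IH !weight_substZ mX dmX.
have -> (u v : {poly {mpoly k[n]}}) :
    map_poly d (u + v) = map_poly d u + map_poly d v.
  by apply/polyP => i; rewrite !(coefD, coef_map_der) dD.
rewrite mulrDr; congr (_ + _); apply/polyP => i.
rewrite [in RHS]coefXnM !coefZ !coefXn coef_map_der !coefZ coefXn.
have [ie|ei] := ltnP i e; first by rewrite ltn_eqF ?mulr0 // ltn_addl.
rewrite -{1}(subnK ei) eqn_add2r; case: eqP => _; last by rewrite !mulr0 d0.
by rewrite !mulr1 !mul_mpolyC dZ.
Qed.

(** Setting the new variable to 1 recovers [p]. *)
Lemma weight_subst_eq0 p : (weight_subst p == 0) = (p == 0).
Proof.
apply/eqP/eqP => [p0|->]; last exact: rmorph0.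
have -> : p = (weight_subst p).[1].
  elim/mpolyind: (p) => [|c m q _ _ IH]; first by rewrite rmorph0 horner0.
  rewrite rmorphD hornerD; congr (_ + _); last exact: IH.
  rewrite /= weight_substZ (whomog_mpolyX m).1 !hornerZ hornerXn.
  by rewrite expr1n mulr1 mul_mpolyC.
by rewrite p0 horner0.
Qed.

(** By [cofactor_monomial], [L] has only a component of weight [e], which is zero when no monomial
    has that weight. *)
Lemma weighted_cofactor_eq0 F L : (forall m, mweight m != e) ->
  F != 0 -> d F = L * F -> L = 0.
Proof.
move=> we F0 dF; apply/eqP; rewrite -weight_subst_eq0; apply/eqP.
set l := weight_subst L.
have le : l`_e = 0.
  rewrite /l; elim/mpolyind: (L) => [|c m q _ _ IH]; first by rewrite rmorph0 coef0.
  rewrite rmorphD coefD [X in _ + X]IH addr0 /= weight_substZ (whomog_mpolyX m).1.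
  by rewrite !coefZ coefXn eq_sym (negbTE (we m)) !mulr0.
have E : 'X^e * map_poly d (weight_subst F) = l * weight_subst F.
  by rewrite -weight_subst_der dF rmorphM.
have f0 : weight_subst F != 0 by rewrite weight_subst_eq0.
by rewrite (cofactor_monomial d0 f0 E) le scale0r.
Qed.

End WeightedDerivation.

(** * The derivation [d4] and the equivalence *)

Section Main.
Variable k : fieldType.

Lemma d4_kderivation : kderivation (d4 k).
Proof. exact: mpoly_der_kderivation. Qed.

Lemma d4_derivation : derivation (d4 k).
Proof.
have [dl dM] := d4_kderivation; split=> // p q.
by have := dl 1 p q; rewrite !scale1r.
Qed.

(** These weights satisfy 2*6 = 7+5, 3+6 = 4+5, 2*4 = 3+5 and 7+4 = 6+5, one equation for each
    variable. *)
Let w (i : 'I_4) : nat := nth 0 [:: 7; 4; 3; 6] i.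

Lemma d4_cofactor_eq0 (F L : {mpoly k[4]}) : F != 0 -> d4 k F = L * F -> L = 0.
Proof.
apply: (@weighted_cofactor_eq0 _ _ w _ 5 d4_kderivation); last first.
  (* 5 is not a sum of copies of 7, 4, 3 and 6. *)
  move=> m; rewrite /mweight !big_ord_recl big_ord0 /w /=.
  by move: (m _) (m _) (m _) (m _) => a b c e; lia.
have [dx dy dz dt] := d4_vars k.
have X i := whomogX k w i.
have HM a b c p q : whomog w a p -> whomog w b q -> (a + b = c)%N ->
  whomog w c (p * q) by move=> pa qb <-; apply: whomogM.
move=> i; have : i \in [:: 0; 1; 2; 3 : 'I_4].
  by case: i => -[|[|[|[|i]]]] lti.
rewrite !inE => /or4P[] /eqP->.
- by rewrite dx expr2; apply: HM (X _) (X _) _.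
- by rewrite dy; apply: HM (X _) (X _) _.
- by rewrite dz expr2; apply: HM (X _) (X _) _.
- by rewrite dt; apply: HM (X _) (X _) _.
Qed.

End Main.

Theorem theorem2p3 (k : fieldType) (char0 : [pchar k] =i pred0) :
  (~ exists F : {mpoly k[4]}, darboux (d4 k) F) <-> trivial_frac_const (d4 k).
Proof.
have dd := d4_derivation k.
have dC (c : k) : d4 k c%:MP = 0.
  by rewrite /d4 /mpoly_der big1 // => i _; rewrite mderivC mulr0.
have fracC (c : k) : frac_const (d4 k) c%:MP%:F.
  by rewrite /frac_const frac_der_tofrac // dC tofrac0.
split=> [noD phi|triv [F [nc [L dF]]]]; last first.
  have F0 : F != 0 by apply/eqP => F0; apply: nc; exists 0; rewrite F0 mpolyC0.
  have L0 := d4_cofactor_eq0 F0 dF.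
  have /triv[c /eqP] : frac_const (d4 k) F%:F.
    by rewrite /frac_const frac_der_tofrac // dF L0 mul0r tofrac0.
  by rewrite tofrac_eq => /eqP FE; apply: nc; exists c.
split=> [dphi|[c ->]]; last exact: fracC.
(* Without Darboux polynomials, only constants can satisfy [d4 k F = L * F]. *)
have const F L : d4 k F = L * F -> exists c : k, F = c%:MP.
  by move=> dF; apply: NNPP => nc; apply: noD; exists F; split=> //; exists L.
have b0 := frac_den_neq0 phi.
have [g [p [q [pE qE cop]]]] :=
  lowest_terms (frac_num phi) (mpoly_factorial b0).
have [g0 q0] : g != 0 /\ q != 0.
  by move: b0; rewrite qE mulf_eq0 negb_or => /andP.
have phiE : phi = p%:F / q%:F.
  rewrite [LHS]frac_numden pE qE !tofracM -mulf_div divff ?mul1r //.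
  by rewrite tofrac_eq0.
have dpq : d4 k p * q = p * d4 k q.
  move: dphi; rewrite /frac_const phiE frac_der_eq // => /eqP.
  rewrite mulf_eq0 invr_eq0 !tofrac_eq0 expf_eq0 (negbTE q0) andbF orbF.
  by rewrite subr_eq0 => /eqP.
(* [q] divides [p * d4 k q] and has no common factor with [p]. *)
have [L dq] : rdivides q (d4 k q) by apply: cop; exists (d4 k p); rewrite -dpq mulrC.
rewrite mulrC in dq; have [c qc] := const _ _ dq.
(* Now [q] is a nonzero constant, so [d4 k p * q = 0]; [const] then applies to [p] with cofactor
   0. *)
have dp : d4 k p = 0 * p.
  by apply: (mulIf q0); rewrite dpq qc dC mulr0 !mul0r.
have [c' pc] := const _ _ dp.
have c0 : c != 0 by apply: contraNneq q0 => c0; rewrite qc c0 mpolyC0.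
exists (c' / c); rewrite phiE; apply: canLR (mulfK _) _; rewrite ?tofrac_eq0 //.
by rewrite pc qc -tofracM -mpolyCM divfK.
Qed.
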